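(* Let $\mathcal{G}=(\mathcal{V},\mathcal{E})$ be a simple undirected graph with $\mathcal{V}=\{1,\dots,n\}$ and let $k\in\{1,\dots,n-1\}$. Then the inequalities $$\sum_{i\in\mathcal{S}}X_{ii}+\bigl(r_k(\mathcal{S})-r_{k-1}(\mathcal{S})\bigr)X_{\ell\ell}\le\sum_{i\in\mathcal{S}}X_{i\ell}+r_k(\mathcal{S})\qquad\text{for all }\mathcal{S}\subseteq\mathcal{V},\ \ell\in\mathcal{V}\setminus\mathcal{S}$$ are valid for $\mathcal{F}_{\mathrm{BSDP}_k}$, i.e., they are satisfied by every $X\in\mathcal{F}_{\mathrm{BSDP}_k}$.
   Context: $\mathcal{F}_{\mathrm{BSDP}_k}$ is the set of symmetric binary matrices $X\in\{0,1\}^{n\times n}$ such that $X_{ij}=0$ for all $\{i,j\}\in\mathcal{E}$ and the $(n+1)\times(n+1)$ matrix $\begin{pmatrix}k&\mathrm{diag}(X)^\top\\ \mathrm{diag}(X)&X\end{pmatrix}$ is positive semidefinite, where $\mathrm{diag}(X)$ is the vector of diagonal entries of $X$. For $\mathcal{S}\subseteq\mathcal{V}$ and $\kappa\in\{1,\dots,k\}$, the $\kappa$-rank $r_\kappa(\mathcal{S})$ is the maximum number of vertices that can be colored in the induced subgraph $\mathcal{G}[\mathcal{S}]$ with at most $\kappa$ colors such that adjacent colored vertices get different colors (each colored vertex receives one color; vertices may be left uncolored), i.e., the maximum number of vertices of a $\kappa$-colorable induced subgraph of $\mathcal{G}[\mathcal{S}]$. Also $r_0(\mathcal{S}):=0$.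 *)

(* Defs.v *)
From mathcomp Require Import all_boot all_order all_algebra.
From mathcomp Require Import reals.

Set Implicit Arguments.
Unset Strict Implicit.
Unset Printing Implicit Defensive.

Import Order.TTheory GRing.Theory Num.Theory.
Local Open Scope ring_scope.

Definition is_psd (R : realType) (m : nat) (M : 'M[R]_m) : Prop :=
  M^T = M /\ forall v : 'cV[R]_m, 0 <= (v^T *m M *m v) 0 0.

Definition diag_col (R : realType) (n : nat) (X : 'M[R]_n) : 'cV[R]_n :=
  \col_i X i i.

(* The feasible set of BSDP_k for the graph on 'I_n with adjacency relation e. *)
Definition F_BSDP (R : realType) (n : nat) (e : rel 'I_n) (k : nat)
    (X : 'M[R]_n) : Prop :=
  [/\ X^T = X,
      forall i j, X i j = 0 \/ X i j = 1,
      forall i j, e i j -> X i j = 0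
    & is_psd (block_mx (k%:R%:M : 'M[R]_1) (diag_col X)^T (diag_col X) X)].

(* [c] partially colors G[S] with [kappa] colors; [None] means uncolored. *)
Definition partial_coloring (n : nat) (e : rel 'I_n) (kappa : nat)
    (S : {set 'I_n}) (c : {ffun 'I_n -> option 'I_kappa}) : bool :=
  [forall i, (c i != None) ==> (i \in S)] &&
  [forall i, forall j, e i j && (c i != None) ==> (c i != c j)].

(* For [kappa = 0] no vertex can be colored, so [kappa_rank e 0 S = 0]. *)
Definition kappa_rank (n : nat) (e : rel 'I_n) (kappa : nat)
    (S : {set 'I_n}) : nat :=
  \max_(c : {ffun 'I_n -> option 'I_kappa} | partial_coloring e S c)
    #|[set i | c i != None]|.

(* Main.v *)
(** The positive semidefinite binary matrix [X] is the indicator of an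
equivalence relation on the vertices [i] with [X i i = 1]; its classes are
stable sets, and testing the bordered matrix on [1] and minus the indicator of
a transversal shows that there are at most [k] of them. Hence the vertices of
[S] with [X i i = 1] are [k]-colorable, and those lying outside the class of
[l], when [X l l = 1], are colored by the other [k - 1] classes. *)
Require Import Defs.
From mathcomp Require Import all_boot all_order all_algebra.
From mathcomp Require Import reals lra.

Set Implicit Arguments.
Unset Strict Implicit.
Unset Printing Implicit Defensive.

Import Order.TTheory GRing.Theory Num.Theory.
Local Open Scope ring_scope.

(** Labels in any finite type serve as colors: a vertex of [A] is colored by the position of its
    label in an enumeration of [f @: A], and all other vertices stay uncolored. *)
Lemma leq_kappa_rank (n : nat) (e : rel 'I_n) (kappa : nat)
    (S A : {set 'I_n}) (T : finType) (f : 'I_n -> T) :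
  A \subset S -> {in A &, forall i j, e i j -> f i != f j} ->
  (#|f @: A| <= kappa)%N -> (#|A| <= kappa_rank e kappa S)%N.
Proof.
move=> /subsetP sAS fA le_kappa.
have index_lt i : i \in A -> (index (f i) (enum (f @: A)) < kappa)%N.
  move=> iA; apply: leq_trans le_kappa.
  by rewrite cardE index_mem mem_enum imset_f.
pose c := [ffun i => if i \in A then
    insub (index (f i) (enum (f @: A))) : option 'I_kappa else None].
have cA i (iA : i \in A) : c i = Some (Ordinal (index_lt i iA)).
  by rewrite ffunE iA; apply: insubT.
have cE i : (c i != None) = (i \in A).
  by case: (boolP (i \in A)) => [/cA -> // | /negPf iA]; rewrite ffunE iA.
have cP : partial_coloring e S c.
  apply/andP; split; first by apply/forallP => i; rewrite cE; apply/implyP/sAS.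
  apply/forallP => i; apply/forallP => j; apply/implyP; rewrite cE.
  case/andP=> eij iA; case: (boolP (j \in A)) => jA; last first.
    by rewrite (cA _ iA) [c j]ffunE (negPf jA).
  rewrite (cA _ iA) (cA _ jA); apply: contra_neq (fA _ _ iA jA eij) => -[eq_index].
  have mem_f x : x \in A -> f x \in enum (f @: A).
    by move=> xA; rewrite mem_enum imset_f.
  by rewrite -(nth_index (f i) (mem_f _ iA)) eq_index nth_index ?mem_f.
have -> : A = [set i | c i != None] by apply/setP => i; rewrite inE cE.
exact: (leq_bigmax_cond
  (F := fun c : {ffun _ -> _} => #|[set i | c i != None]|)).
Qed.

Section FeasibleMatrix.
Variables (R : realType) (n : nat) (e : rel 'I_n) (k : nat) (X : 'M[R]_n).
Hypothesis hX : F_BSDP e k X.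

Lemma feasible_sym i j : X i j = X j i.
Proof. by case: hX => XT _ _ _; rewrite -[in LHS]XT mxE. Qed.

Lemma feasible01 i j : X i j = 0 \/ X i j = 1.
Proof. by case: hX. Qed.

(** This is the quadratic form of the bordered matrix at the vector with first entry [a] followed by
    the combination of unit vectors listed in [s]. The list form lets small explicit test vectors be
    expanded term by term. *)
Lemma feasible_quad_ge0 (a : R) (s : seq (R * 'I_n)) :
  0 <= a ^+ 2 * k%:R + 2 * a * (\sum_(p <- s) p.1 * X p.2 p.2)
       + \sum_(p <- s) \sum_(q <- s) p.1 * q.1 * X p.2 q.2.
Proof.
case: hX => _ _ _ [_ psd].
pose u : 'cV[R]_n := \sum_(p <- s) p.1 *: delta_mx p.2 0.
have uTM m (M : 'M[R]_(n, m)) :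
    u^T *m M = \sum_(p <- s) p.1 *: row p.2 M.
  rewrite /u linear_sum /= mulmx_suml; apply: eq_bigr => p _.
  by rewrite linearZ /= trmx_delta -scalemxAl -rowE.
have eq_cross : u^T *m diag_col X = (\sum_(p <- s) p.1 * X p.2 p.2)%:M.
  rewrite uTM [LHS]mx11_scalar summxE; congr (_%:M).
  by apply: eq_bigr => p _; rewrite !mxE.
have eq_quad : (u^T *m X *m u) 0 0 =
    \sum_(p <- s) \sum_(q <- s) p.1 * q.1 * X p.2 q.2.
  rewrite uTM mulmx_suml summxE; apply: eq_bigr => p _.
  rewrite -scalemxAl mxE /u mulmx_sumr summxE mulr_sumr.
  apply: eq_bigr => q _.
  by rewrite -scalemxAr -colE !mxE mulrA.
have := psd (col_mx a%:M u).
rewrite tr_col_mx tr_scalar_mx mul_row_block mul_row_col !mulmxDl.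
have -> : a%:M *m (diag_col X)^T *m u
    = (a * \sum_(p <- s) p.1 * X p.2 p.2)%:M.
  rewrite mul_scalar_mx -scalemxAl -[_ *m u]trmxK trmx_mul trmxK eq_cross.
  by rewrite tr_scalar_mx scale_scalar_mx.
rewrite eq_cross -!scalar_mxM.
rewrite !mxE -eq_quad !mulr1n [in X in _ -> X]mulrC.
set t := \sum_(p <- s) _; rewrite [(_ *m u) 0 0]mxE.
lra.
Qed.

Lemma feasible_diag i j : X i j = 1 -> X i i = 1.
Proof.
move=> Xij; case: (feasible01 i i) => // Xii.
(* If [X i i = 0], the form takes the value [X j j - 2 < 0] here. *)
have := feasible_quad_ge0 0 [:: (-1, i); (1, j)].
rewrite !big_cons !big_nil /= [X j i]feasible_sym Xij Xii.
by case: (feasible01 j j) => ->; lra.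
Qed.

Lemma feasible_trans i j l : X i j = 1 -> X j l = 1 -> X i l = 1.
Proof.
move=> Xij Xjl; case: (feasible01 i l) => // Xil.
have Xii := feasible_diag Xij; have Xjj := feasible_diag Xjl.
have Xll : X l l = 1 by apply: (@feasible_diag l j); rewrite feasible_sym.
(* With [X i l = 0] the form equals 3 - 4 = -1: three unit diagonal entries, and the pairs [i], [j]
   and [j], [l] each contribute -2. *)
have := feasible_quad_ge0 0 [:: (1, i); (-1, j); (1, l)].
rewrite !big_cons !big_nil /= [X j i]feasible_sym [X l i]feasible_sym.
by rewrite [X l j]feasible_sym Xij Xjl Xil Xii Xjj Xll; lra.
Qed.

Lemma feasible_transversal_card (B : {set 'I_n}) :
  {in B, forall b, X b b = 1} ->
  {in B &, forall b c, b != c -> X b c = 0} -> (#|B| <= k)%N.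
Proof.
move=> XBB XBC.
(* The value is [k - 2 * #|B| + #|B|], since [X] restricted to [B] is the identity. *)
have := feasible_quad_ge0 1 [seq (-1, b) | b <- enum B].
rewrite !big_map !big_enum /=.
under eq_bigr => b bB do rewrite XBB // mulr1.
under [X in _ + X]eq_bigr => b bB.
  rewrite big_map big_enum /= (bigD1 b) //= XBB // big1 ?addr0; last first.
    by move=> c /andP[cB ncb]; rewrite XBC ?mulr0 // eq_sym.
  rewrite mulr1 mulrNN mulr1.
  over.
rewrite !sumr_const -(ler_nat R) mulNrn; lra.
Qed.

(** The choice depends only on which entries of row [i] are 1, so equivalent vertices share a
    representative. The default [i] is never reached when [X i i = 1]. *)
Definition class_repr i := odflt i [pick j | X i j == 1].

Lemma class_reprP i : X i i = 1 -> X i (class_repr i) = 1.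
Proof.
by move=> Xii; rewrite /class_repr; case: pickP => [j /eqP|].
Qed.

Lemma eq_class_repr i j : X i i = 1 -> X j j = 1 ->
  (class_repr i == class_repr j) = (X i j == 1).
Proof.
move=> Xii Xjj; apply/eqP/eqP => [eq_repr | Xij].
  apply: (feasible_trans (class_reprP Xii)).
  by rewrite eq_repr feasible_sym class_reprP.
rewrite /class_repr (@eq_pick _ (fun h => X i h == 1) (fun h => X j h == 1)).
  by case: pickP => // /(_ j); rewrite Xjj eqxx.
move=> h; apply/eqP/eqP => Xh; last exact: feasible_trans Xij Xh.
by apply: feasible_trans Xh; rewrite feasible_sym.
Qed.

(** The representatives form a transversal: an entry 1 between two of them would merge their classes
    by transitivity. *)
Lemma card_class_reprs : (#|class_repr @: [set i | X i i == 1%R]| <= k)%N.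
Proof.
have reprX i : X i i = 1 -> X (class_repr i) i = 1.
  by move=> Xii; rewrite feasible_sym class_reprP.
apply: feasible_transversal_card => [b /imsetP[i] |
  _ _ /imsetP[i + ->] /imsetP[j + ->]].
  by rewrite inE => /eqP Xii ->; apply: feasible_diag (reprX _ Xii).
rewrite !inE => /eqP Xii /eqP Xjj; rewrite eq_class_repr // => /eqP nXij.
case: (feasible01 (class_repr i) (class_repr j)) => // Xr; case: nXij.
exact: feasible_trans (feasible_trans (class_reprP Xii) Xr) (reprX _ Xjj).
Qed.

Lemma class_repr_adj (A : {set 'I_n}) : {in A, forall i, X i i = 1} ->
  {in A &, forall i j, e i j -> class_repr i != class_repr j}.
Proof.
move=> XA i j iA jA eij; rewrite eq_class_repr ?XA //.
by case: hX => _ _ Xe _; rewrite Xe // eq_sym oner_eq0.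
Qed.

Lemma leq_card_active (S : {set 'I_n}) :
  (#|[set i in S | X i i == 1%R]| <= kappa_rank e k S)%N.
Proof.
apply: (leq_kappa_rank (f := class_repr)).
- by apply/subsetP => i; rewrite inE => /andP[].
- by apply: class_repr_adj => i; rewrite inE => /andP[_ /eqP].
- apply: leq_trans card_class_reprs; apply/subset_leq_card/imsetS.
  by apply/subsetP => i; rewrite !inE => /andP[].
Qed.

(** The class of [l] uses up one of the at most [k] labels, and no vertex counted here carries
    it. *)
Lemma leq_card_active_off_class (S : {set 'I_n}) (l : 'I_n) : X l l = 1 ->
  (#|[set i in S | (X i i == 1%R) && (X i l != 1%R)]| <= kappa_rank e k.-1 S)%N.
Proof.
move=> Xll; apply: (leq_kappa_rank (f := class_repr)).
- by apply/subsetP => i; rewrite inE => /andP[].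
- by apply: class_repr_adj => i; rewrite inE => /and3P[_ /eqP].
have := card_class_reprs.
rewrite (cardsD1 (class_repr l)) imset_f ?inE ?Xll ?eqxx // add1n.
(* The case [k = 0] is contradictory, because the class of [l] already counts for one. *)
case: (k) => // k'; rewrite ltnS; apply: leq_trans.
apply/subset_leq_card/subsetP => _ /imsetP[i + ->].
rewrite !inE => /and3P[_ Xii nXil].
by rewrite eq_class_repr ?(eqP Xii) // nXil imset_f ?inE.
Qed.

End FeasibleMatrix.

Theorem theorem4p5 (R : realType) (n : nat) (e : rel 'I_n)
    (e_sym : symmetric e) (e_irr : irreflexive e)
    (k : nat) (hk : (1 <= k <= n - 1)%N)
    (S : {set 'I_n}) (l : 'I_n) (hl : l \notin S)
    (X : 'M[R]_n) (hX : F_BSDP e k X) :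
  \sum_(i in S) X i i
    + ((kappa_rank e k S)%:R - (kappa_rank e k.-1 S)%:R) * X l l
  <= \sum_(i in S) X i l + (kappa_rank e k S)%:R.
Proof.
have sum_indicator (P : pred 'I_n) (F : 'I_n -> R) :
    (forall i, F i = (P i)%:R) -> \sum_(i in S) F i = #|[set i in S | P i]|%:R.
  move=> FE; under eq_bigr do rewrite FE.
  rewrite -natr_sum -sum1_card big_mkcond /= [in RHS]big_mkcond /=.
  congr (_%:R); apply: eq_bigr => i _; rewrite inE.
  by case: (i \in S); case: (P i).
(* If [X l l = 0], column [l] vanishes and the count of active vertices of [S] suffices. *)
case: (feasible01 hX l l) => Xll.
  rewrite Xll mulr0 addr0 [X in _ <= X + _]big1 ?add0r => [|i _]; last first.
    case: (feasible01 hX i l) => // Xil.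
    have := feasible_diag hX (etrans (feasible_sym hX l i) Xil).
    by move/eqP; rewrite Xll eq_sym oner_eq0.
  rewrite (sum_indicator (fun i => X i i == 1)) ?ler_nat ?leq_card_active // => i.
  by case: (feasible01 hX i i) => ->; rewrite ?eqxx // eq_sym oner_eq0.
(* For [X l l = 1] the [k]-rank cancels and this bound remains. Since [X i l = 1] forces
   [X i i = 1], each summand is the indicator of an active vertex outside the class of [l]. *)
have : \sum_(i in S) (X i i - X i l) <= (kappa_rank e k.-1 S)%:R.
  rewrite (sum_indicator (fun i => (X i i == 1) && (X i l != 1))) => [|i].
    by rewrite ler_nat leq_card_active_off_class.
  case: (feasible01 hX i l) => Xil; last first.
    by rewrite Xil (feasible_diag hX Xil) eqxx subrr.
  rewrite Xil subr0 [0 == 1]eq_sym oner_eq0 andbT.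
  by case: (feasible01 hX i i) => ->; rewrite ?eqxx // eq_sym oner_eq0.
by rewrite sumrB Xll mulr1; lra.
Qed.
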